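(* Let $d$ be a positive integer and let $S\subset\mathbb{R}^d$ be a finite set. Suppose that $\dim\big(T_2(S)\big)\le 0$. Then $$\sum_{r=1}^{|S|}\dim(T_r(S))\ge 0.$$
   Context: For a finite set $S\subset\mathbb{R}^d$ and a positive integer $r$, $T_r(S)$ is the set of points $p\in\mathbb{R}^d$ for which there exists a partition of $S$ into $r$ parts $A_1,\dots,A_r$ with $p\in\operatorname{conv}(A_i)$ for all $i=1,\dots,r$. Here $\dim$ denotes Lebesgue covering dimension: for a compact metric space $Y$, $\dim Y\le k$ means that every finite open cover of $Y$ has a finite open refinement of order at most $k+1$ (i.e. any $k+2$ distinct members of the refinement have empty intersection). By convention $\dim(\emptyset)=-1$. *)

(* Defs.v *)
From HB Require Import structures.
From mathcomp Require Import all_boot all_order all_algebra finmap.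
From mathcomp Require Import all_classical all_reals all_analysis.

Set Implicit Arguments.
Unset Strict Implicit.
Unset Printing Implicit Defensive.

Import Order.TTheory GRing.Theory Num.Theory.
Import numFieldNormedType.Exports.

Local Open Scope classical_set_scope.
Local Open Scope ring_scope.

Definition finite_open_cover (Y : topologicalType) (U : set (set Y)) : Prop :=
  [/\ finite_set U, (forall A, U A -> open A) & \bigcup_(A in U) A = setT].

Definition refines (T : Type) (V U : set (set T)) : Prop :=
  forall B, V B -> exists2 A, U A & B `<=` A.

(* Covers are sets of subsets, so a subfamily [W] of cardinality [n.+1]
   consists of [n.+1] distinct members. *)
Definition order_at_most (T : Type) (V : set (set T)) (n : nat) : Prop :=
  forall W : set (set T), W `<=` V -> (W #= `I_n.+1)%card ->
    \bigcap_(B in W) B = set0.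

Definition covering_dim_le (Y : topologicalType) (k : nat) : Prop :=
  forall U : set (set Y), finite_open_cover U ->
    exists V : set (set Y),
      [/\ finite_open_cover V, refines V U & order_at_most V k.+1].

(* [+oo] when no [k] satisfies [covering_dim_le Y k] *)
Definition covering_dim (R : realType) (Y : topologicalType) : \bar R :=
  if `[< [set: Y] = set0 >] then (-1)%:E
  else ereal_inf [set k%:R%:E | k in [set k : nat | covering_dim_le Y k]].

Definition conv_hull (R : realType) (d : nat) (A : set 'rV[R]_d) :
    set 'rV[R]_d :=
  smallest (@convex_set R 'rV[R]_d) A.

Definition tverberg_set (R : realType) (d : nat) (S : {fset 'rV[R]_d})
    (r : nat) : set 'rV[R]_d :=
  [set p | exists2 A : 'I_r -> set 'rV[R]_d,
     partition [set: 'I_r] A [set` S] & forall i, conv_hull (A i) p].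

(* The [set_type] coercion equips a set with its subspace topology. *)
Definition tverberg_dim (R : realType) (d : nat) (S : {fset 'rV[R]_d})
    (r : nat) : \bar R :=
  covering_dim R (tverberg_set S r : Type).

(* Main.v *)
Require Import Defs.
From mathcomp Require Import all_boot all_order all_algebra finmap.
From mathcomp Require Import all_classical all_reals all_analysis.
From mathcomp Require Import zify ring lra.

(** Let [S] have [n > 0] points and an affine hull of dimension [k]; for empty [S]
    the sum is empty. Each term of the sum is at least -1, and at least 0 if the
    Tverberg set is nonempty. The first term is at least [k], by Lebesgue's
    covering theorem ([tverberg_dim1_ge]). So it suffices that the Tverberg sets of
    index at most [n - k] are nonempty ([tverberg_nonempty]); this is clear if
    [n = k + 1].

    Consider the affine dependences [v] among the points, a space of dimension
    [n - k - 1]. A nonzero [v] yields a Radon point, the mean of the points weighted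
    by the positive part of [v], and this is a point of the second Tverberg set
    depending continuously on [v]. As that set has dimension at most zero, all
    Radon points coincide ([radon_point_constant]) with a single point [o]. Let [L]
    be the space of linear dependences of the points seen from [o]; its dimension
    is at least [n - k], and it contains the positive parts of all affine
    dependences. Therefore the minimum of two vectors of [L] that are nonnegative
    and have mass one is again in [L], which forces inclusion-minimal supports of
    nonnegative vectors of [L] to be disjoint, while these vectors span [L]
    ([disjoint_weights]). There are thus at least [n - k] disjoint sets of points
    whose convex hulls contain [o].

    Lebesgue's theorem ([covering_dim_simplex]) is derived from a discrete lemma of
    Sperner type on grid points of a simplex ([sperner_grid]). Following Scarf, the
    cells of a triangulation are replaced by sets that are dominant for several
    linear orders, and the parity argument of Sperner applies to them
    ([colourful_dominant_set]), because such a set with one element removed extends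
    to a dominant set in at most two ways ([rooms_of_door]). *)

Set Implicit Arguments.
Unset Strict Implicit.
Unset Printing Implicit Defensive.

(** * Colourful dominant sets *)

Section Dominant.
(* Inside this section the set vocabulary is that of finite sets. *)
Import mathcomp.boot.fintype mathcomp.boot.finset.
Variables (E I : finType) (rk : I -> E -> nat).
Hypothesis rk_inj : forall i, injective (rk i).

(** Scarf's dominance: no element lies, for all the orders at once, strictly above
    the minimum of [B]. The dominant sets with [#|I|] elements, called rooms below, play the
    part of the top cells of a triangulated simplex; those with one element
    less, called doors, that of the walls between them. *)
Definition dominant (B : {set E}) : bool :=
  [forall t, exists i, forall b in B, rk i t <= rk i b].

Lemma dominantP (B : {set E}) :
  reflect (forall t, exists i, forall b, b \in B -> rk i t <= rk i b)
          (dominant B).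
Proof.
apply: (iffP forallP) => [H t|H t].
  by have /existsP[i /forall_inP Hi] := H t; exists i.
by have [i Hi] := H t; apply/existsP; exists i; apply/forall_inP.
Qed.

Lemma dominantS (A B : {set E}) : A \subset B -> dominant B -> dominant A.
Proof.
move=> /subsetP sAB /dominantP domB; apply/dominantP => t.
by have [i Hi] := domB t; exists i => b /sAB /Hi.
Qed.

Section Door.
Variables (D : {set E}) (argmin : I -> E).
Hypothesis domD : dominant D.
Hypothesis cardD : #|D|.+1 = #|I|.
Hypothesis argmin_in : forall i, argmin i \in D.
Hypothesis argmin_le : forall i x, x \in D -> rk i (argmin i) <= rk i x.

Lemma argmin_unique i x :
  x \in D -> (forall y, y \in D -> rk i x <= rk i y) -> argmin i = x.
Proof.
move=> Dx xmin; apply: (@rk_inj i); apply/eqP.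
by rewrite eqn_leq argmin_le // xmin.
Qed.

Lemma argmin_onto x : x \in D -> exists i, argmin i = x.
Proof.
move=> Dx; have /dominantP/(_ x)[i Hi] := domD.
by exists i; apply: argmin_unique.
Qed.

Lemma imset_argmin (A : {set I}) :
  (forall l, exists2 l', l' \in A & argmin l' = argmin l) -> argmin @: A = D.
Proof.
move=> HA; apply/setP => x; apply/imsetP/idP => [[l _ ->] //|Dx].
have [l <-] := argmin_onto Dx; have [l' l'A <-] := HA l; by exists l'.
Qed.

(** Every element of the dominant set [D] is the minimum of [D] for some order,
    so [argmin] maps [I] onto a set with one element less: exactly one pair of
    indices shares its minimizer. *)
Lemma argmin_pair :
  exists p : I * I, [/\ p.1 != p.2, argmin p.1 = argmin p.2 &
    forall l l', l != l' -> argmin l = argmin l' ->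
      (l, l') = p \/ (l', l) = p].
Proof.
have [i [j [ij amij]]] : exists i j, i != j /\ argmin i = argmin j.
  have /injectivePn[i [j ij amij]] : ~~ injectiveb argmin.
    apply/negP => /injectiveP inj.
    have := card_imset [set: I] inj; rewrite imset_argmin; last first.
      by move=> l; exists l.
    by rewrite cardsT; lia.
  by exists i, j.
have injC a b : a != b -> argmin a = argmin b -> {in [set~ a] &, injective argmin}.
  move=> ab amab; apply/imset_injP; rewrite cardsC1 -cardD /= imset_argmin //.
  move=> l; have [->|la] := eqVneq l a; last by exists l; rewrite ?inE.
  by exists b; rewrite ?inE // eq_sym.
exists (i, j); split => //= l l' ll' amll'.
have := injC _ _ ij amij l l'; have := injC j i _ _ l l'.
rewrite eq_sym ij amij !inE => /(_ erefl erefl) Hj Hi.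
have [li|li] := eqVneq l i.
  left; have [->|l'j] := eqVneq l' j; first by rewrite li.
  move: Hj; rewrite li ij l'j -li => /(_ isT isT amll') e.
  by rewrite e eqxx in ll'.
have [l'i|l'i] := eqVneq l' i.
  right; have [->|lj] := eqVneq l j; first by rewrite l'i.
  move: Hj; rewrite l'i ij lj -l'i => /(_ isT isT amll') e.
  by rewrite e eqxx in ll'.
by move: (Hi li l'i amll') ll' => ->; rewrite eqxx.
Qed.

Definition above l : {set E} :=
  [set t | [forall l', (l' != l) ==> (rk l' (argmin l') < rk l' t)]].

Lemma aboveP l t :
  reflect (forall l', l' != l -> rk l' (argmin l') < rk l' t) (t \in above l).
Proof.
rewrite inE; apply: (iffP forallP) => [H l' /(implyP (H l'))//|H l'].
by apply/implyP => /H.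
Qed.

Definition top_above l : {set E} :=
  [set x in above l | [forall t in above l, rk l t <= rk l x]].

Lemma top_aboveP l x :
  reflect (x \in above l /\ forall t, t \in above l -> rk l t <= rk l x)
          (x \in top_above l).
Proof.
rewrite [_ \in top_above _]inE.
by apply: (iffP andP) => -[xa /forall_inP].
Qed.

Lemma card_top_above l : #|top_above l| = (above l != set0).
Proof.
have [e|/set0Pn[x0 x0a]] := eqVneq (above l) set0.
  apply/eqP; rewrite cards_eq0 -subset0; apply/subsetP => x /top_aboveP[].
  by rewrite e.
have [x xa xmax] := @arg_maxnP _ x0 (mem (above l)) (rk l) x0a.
apply/eqP/cards1P; exists x; apply/setP => y; rewrite in_set1.
apply/top_aboveP/eqP => [[ya ymax]|->]; last by split => // t /xmax.
apply: (@rk_inj l); apply/eqP.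
by rewrite eqn_leq ymax // andbT; apply: xmax.
Qed.

(** How a door [D] extends to rooms: a new element [x] must become the minimum
    for some index, and the elements of [D] remain minima for others, so [x]
    replaces one of the two indices that share a minimizer. For that index,
    dominance forces [x] to be the highest of the elements lying above all
    other minima. Hence a door is in at most two rooms. *)
Lemma rooms_of_door i j : i != j -> argmin i = argmin j ->
  (forall l l', l != l' -> argmin l = argmin l' ->
      (l, l') = (i, j) \/ (l', l) = (i, j)) ->
  [set x | x \notin D & dominant (x |: D)] = top_above i :|: top_above j.
Proof.
move=> ij amij only.
(* [a] stands for either index of the pair, [b] for the other one. *)
have suff_top a b x : a != b -> argmin a = argmin b -> x \in top_above a ->
    x \notin D /\ dominant (x |: D).
  move=> ab amab /top_aboveP[/aboveP xa xmax]; split.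
    apply/negP => Dx; have [l el] := argmin_onto Dx.
    have [la|la] := eqVneq l a.
      by have := xa b; rewrite eq_sym ab -amab -la el ltnn => /(_ isT).
    by have := xa l la; rewrite el ltnn.
  apply/dominantP => t.
  have [ta|/aboveP ta] := boolP (t \in above a).
    exists a => y; rewrite in_setU1 => /predU1P[->|Dy]; first exact: xmax.
    have /dominantP/(_ t)[l Hl] := domD; have [la|la] := eqVneq l a.
      by rewrite -la; apply: Hl.
    by move/aboveP/(_ l la): ta; rewrite ltnNge Hl.
  have [l la tl] : exists2 l, l != a & rk l t <= rk l (argmin l).
    apply/exists_inP; rewrite -[X in is_true X]negbK; apply/negP.
    move/exists_inPn => H; apply: ta => l la; have := H l la.
    by rewrite -ltnNge.
  exists l => y; rewrite in_setU1 => /predU1P[->|Dy].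
    by apply: leq_trans tl (ltnW (xa l la)).
  exact: leq_trans tl (argmin_le _ Dy).
apply/setP => x; rewrite in_setU [LHS]inE.
apply/andP/orP => [[xD domx]|[xi|xj]]; last 2 first.
- exact: (suff_top i j).
- by apply: (suff_top j i) xj; rewrite 1?eq_sym.
(* [l] is an index for which [x] is minimal. *)
have [l xl] : exists l, forall b, b \in x |: D -> rk l x <= rk l b.
  by have /dominantP/(_ x) := domx.
(* An element of [D] stays minimal in [x |: D] for some index, and that index
   cannot be [l]. *)
have key l' y : l' != l -> y \in D -> argmin l' = y ->
    (forall m, argmin m = y -> m = l \/ m = l') -> rk l' y < rk l' x.
  move=> l'l Dy amy uy; have /dominantP/(_ y)[m Hm] := domx.
  have em : argmin m = y.
    by apply: argmin_unique => // z Dz; apply: Hm; rewrite in_setU1 Dz orbT.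
  have mx : rk m y < rk m x.
    rewrite ltn_neqAle Hm ?setU11 // andbT; apply/eqP => /rk_inj yx.
    by rewrite -yx Dy in xD.
  case: (uy _ em) => ml; last by rewrite -ml.
  move: mx; rewrite ml ltnNge xl //; by rewrite in_setU1 Dy orbT.
have lij : l = i \/ l = j.
  have /dominantP/(_ (argmin l))[m Hm] := domx.
  have em : argmin m = argmin l.
    by apply: argmin_unique => // z Dz; apply: Hm; rewrite in_setU1 Dz orbT.
  have [ml|ml] := eqVneq m l; last first.
    by case: (only _ _ ml em) => -[e1 e2]; [right|left].
  have : rk l (argmin l) <= rk l x by rewrite -{1 3}ml Hm ?setU11.
  have := xl (argmin l); rewrite in_setU1 argmin_in orbT => /(_ isT) h1 h2.
  have e : x = argmin l by apply: (@rk_inj l); apply/eqP; rewrite eqn_leq h1 h2.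
  by rewrite e argmin_in in xD.
have xa : x \in above l.
  apply/aboveP => l' l'l; apply: (key l' (argmin l')) => // m em.
  have [->|ml'] := eqVneq m l'; first by right.
  left; case: (only _ _ ml' em) => -[e1 e2]; case: lij => ll.
  - by rewrite e1 ll.
  - by rewrite e2 ll eqxx in l'l.
  - by rewrite e1 ll eqxx in l'l.
  - by rewrite e2 ll.
have xtop : x \in top_above l.
  apply/top_aboveP; split => // t /aboveP ta.
  have /dominantP/(_ t)[m Hm] := domx.
  have [ml|ml] := eqVneq m l; first by rewrite -ml Hm ?setU11.
  by have := ta _ ml; rewrite ltnNge Hm // in_setU1 argmin_in orbT.
by case: lij => <-; [left|right].
Qed.

(** A common element would exceed all the minima of [D], against dominance. *)
Lemma disjoint_top_above i j : i != j -> top_above i :&: top_above j = set0.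
Proof.
move=> ij; apply/eqP; rewrite -subset0; apply/subsetP => x.
rewrite inE => /andP[/top_aboveP[/aboveP xi _] /top_aboveP[/aboveP xj _]].
have /dominantP/(_ x)[l Hl] := domD.
have [li|li] := eqVneq l i.
  by have := xj l; rewrite li ij ltnNge -li Hl // => /(_ isT).
by have := xi l li; rewrite ltnNge Hl.
Qed.

End Door.
End Dominant.

Section ColourfulRoom.
Import mathcomp.boot.fintype mathcomp.boot.finset.
(* [slack i] acts as a vertex at infinity opposite to the facet [i]: it is below
   everything for the order [i] and above all genuine elements for the other
   orders. *)
Variables (E I : finType) (rk : I -> E -> nat) (c : E -> I) (slack : I -> E).
Hypothesis rk_inj : forall i, injective (rk i).
Hypothesis slack_inj : injective slack.
Hypothesis slack_low : forall i x, x != slack i -> rk i (slack i) < rk i x.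
Hypothesis slack_high : forall i j x, i != j ->
  x \notin codom slack -> rk i x < rk i (slack j).
Hypothesis c_slack : forall i, c (slack i) = i.
Hypothesis inhabited : exists x, x \notin codom slack.
Hypothesis cardI : 1 < #|I|.

Let room (B : {set E}) := dominant rk B && (#|B| == #|I|).
Let rooms_at (D : {set E}) := [set x | x \notin D & room (x |: D)].
Let outer i0 := slack @: [set~ i0].

Lemma card_outer i0 : #|outer i0|.+1 = #|I|.
Proof. by rewrite card_imset // cardsC1; lia. Qed.

Lemma outer_dominant i0 : dominant rk (outer i0).
Proof.
apply/dominantP => t; have [/codomP[j ->]|tT] := boolP (t \in codom slack).
  exists j => x _; have [->//|xj] := eqVneq x (slack j).
  exact/ltnW/slack_low.
exists i0 => x /imsetP[j]; rewrite in_setC1 => ji0 ->.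
by apply/ltnW/slack_high; rewrite // eq_sym.
Qed.

Lemma argmin_exists (D : {set E}) : D != set0 ->
  exists argmin : I -> E, (forall i, argmin i \in D) /\
    forall i x, x \in D -> rk i (argmin i) <= rk i x.
Proof.
move=> /set0Pn[x0 x0D].
exists (fun i => [arg min_(x < x0 in D) rk i x]).
by split=> [i|i x]; case: arg_minnP => // y yD ymin; apply: ymin.
Qed.

Lemma rooms_at_dominant (D : {set E}) : #|D|.+1 = #|I| ->
  rooms_at D = [set x | x \notin D & dominant rk (x |: D)].
Proof.
move=> cD; apply/setP => x; rewrite !inE /room.
by case: (boolP (x \in D)) => //= xD; rewrite cardsU1 xD add1n cD eqxx andbT.
Qed.

(** A door whose colours are all but [i0] lies in exactly two rooms, unless it
    consists of slack elements only: that one is on the boundary and lies in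
    exactly one room. *)
Lemma odd_rooms_at (D : {set E}) i0 :
  dominant rk D -> #|D|.+1 = #|I| -> c @: D = [set~ i0] ->
  odd #|rooms_at D| = (D == outer i0).
Proof.
move=> domD cD cDi0; rewrite rooms_at_dominant //.
have /argmin_exists[argmin [argmin_in argmin_le]] : D != set0.
  by rewrite -card_gt0; lia.
have [[i j] /= [ij amij only]] := argmin_pair rk_inj domD cD argmin_in argmin_le.
rewrite (rooms_of_door rk_inj domD argmin_in argmin_le ij amij only) cardsU.
rewrite (disjoint_top_above domD _ ij) // cards0 subn0.
rewrite !(card_top_above rk_inj) oddD !oddb.
have [Dout|Dout] := eqVneq D (outer i0); last first.
  have [x xD xT] : exists2 x, x \in D & x \notin codom slack.
    apply/exists_inP; rewrite -[X in is_true X]negbK; apply/negP.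
    move/exists_inPn => H; move/eqP: Dout; apply; apply/eqP.
    rewrite eqEcard; apply/andP; split; last first.
      by rewrite -ltnS cD card_outer.
    apply/subsetP => x xD; have := H x xD; rewrite negbK => /codomP[k xk].
    rewrite xk; apply: imset_f; rewrite -cDi0 -[k]c_slack -xk.
    exact: imset_f.
  have above0 l : above rk argmin l != set0.
    apply/set0Pn; exists (slack l); apply/aboveP => l' l'l.
    by apply: leq_ltn_trans (argmin_le l' x xD) _; apply: slack_high.
  by rewrite !above0.
have am_slack l : l != i0 -> argmin l = slack l.
  move=> li0; apply: (argmin_unique rk_inj argmin_in argmin_le).
    by rewrite Dout; apply: imset_f; rewrite in_setC1.
  move=> y _; have [->//|yl] := eqVneq y (slack l); exact/ltnW/slack_low.
(* In the outer door the repeated minimizer involves the index [i0], the only one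
   whose own slack element is missing. *)
wlog ii0 : i j ij amij only / i = i0.
  move=> W; have [e|ii0] := eqVneq i i0; first exact: (W i j).
  have [e|ji0] := eqVneq j i0.
    rewrite addbC; apply: (W j i) => //; rewrite 1?eq_sym // => l l' ll' e2.
    by case: (only l l' ll' e2) => -[-> ->]; [right|left].
  by move: amij ij; rewrite !am_slack // => /slack_inj ->; rewrite eqxx.
move: ij amij => {only}; rewrite {}ii0 eq_sym => ji0 ami0.
have -> : above rk argmin i0 != set0.
  have [t tT] := inhabited; apply/set0Pn; exists t; apply/aboveP => l li0.
  rewrite am_slack //; apply: slack_low; apply: contra tT => /eqP ->.
  exact: codom_f.
suff -> : above rk argmin j = set0 by rewrite eqxx.
apply/eqP; rewrite -subset0; apply/subsetP => x /aboveP xj.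
have := xj i0; rewrite eq_sym ji0 ami0 (am_slack j) // => /(_ isT) x0.
have /codomP[k xk] : x \in codom slack.
  apply/negPn/negP => xT; have := slack_high _ xT; move=> /(_ i0 j).
  by rewrite eq_sym ji0 ltnNge ltnW // => /(_ isT).
have ki0 : k != i0.
  apply/eqP => ek; move: x0; rewrite xk ek ltnNge ltnW //.
  by apply: slack_low; rewrite (inj_eq slack_inj).
have kj : k != j by apply/eqP => ek; move: x0; rewrite xk ek ltnn.
by have := xj k kj; rewrite am_slack // xk ltnn.
Qed.

(** In a room that misses some colour, the doors with colours all but [i0]
    arise by deleting one of two elements of equal colour, so there are none or
    two of them. *)
Lemma odd_doors_of (B : {set E}) i0 : #|B| = #|I| -> c @: B != [set: I] ->
  ~~ odd #|[set x in B | c @: (B :\ x) == [set~ i0]]|.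
Proof.
move=> cB cBT; set X := [set x in B | _].
have [->|/set0Pn[x]] := eqVneq X set0; first by rewrite cards0.
rewrite inE => /andP[xB /eqP cBx].
have cBe : c @: B = [set~ i0].
  apply/eqP; rewrite eqEsubset -{2}cBx imsetS ?subsetDl // andbT.
  apply/subsetP => k kB; rewrite in_setC1; apply: contra cBT => /eqP ki0.
  rewrite eqEsubset subsetT /=; apply/subsetP => l _.
  have [->|li0] := eqVneq l i0; first by rewrite -ki0.
  have : l \in c @: (B :\ x) by rewrite cBx in_setC1.
  by apply/subsetP/imsetS/subsetDl.
have injc : {in B :\ x &, injective c}.
  apply/imset_injP; rewrite cBx cardsC1.
  by have := cardsD1 x B; rewrite xB cB; lia.
have [y yBx cyx] : exists2 y, y \in B :\ x & c x = c y.
  by apply/imsetP; rewrite cBx -cBe imset_f.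
have [yx yB] : y != x /\ y \in B by move: yBx; rewrite in_setD1 => /andP.
suff -> : X = [set x; y] by rewrite cards2 eq_sym yx.
apply/setP => z; rewrite inE in_set2.
have [->|zx] := eqVneq z x; first by rewrite xB cBx eqxx.
have [->|zy] := eqVneq z y.
  rewrite yB /=; apply/eqP; rewrite -cBe; apply/eqP.
  rewrite eqEsubset imsetS ?subsetDl //=; apply/subsetP => k /imsetP[w wB ->].
  have [->|wy] := eqVneq w y; last by apply: imset_f; rewrite in_setD1 wy.
  by rewrite -cyx; apply: imset_f; rewrite in_setD1 eq_sym yx.
apply/negP => /andP[zB /eqP cBz].
have : c z \in c @: (B :\ z) by rewrite cBz -cBe imset_f.
case/imsetP => w; rewrite in_setD1 => /andP[wz wB] czw.
have zBx : z \in B :\ x by rewrite in_setD1 zx.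
have [wx|wx] := eqVneq w x.
  by move: zy; rewrite (injc z y) ?eqxx // czw wx.
by move: wz; rewrite (injc z w) ?eqxx // in_setD1 wx.
Qed.

(** Sperner's parity argument: count the incidences between rooms and doors
    with colours all but [i0]. The doors contribute an odd number, because of the
    single outer door, and each room that is not colourful an even one. *)
Theorem colourful_dominant_set :
  exists B : {set E}, [/\ dominant rk B, #|B| = #|I| & c @: B = [set: I]].
Proof.
have [i0 _] : exists i0 : I, i0 \in I by apply/card_gt0P; exact: ltnW.
pose g (D : {set E}) := c @: D == [set~ i0].
have count : \sum_(B | room B) #|[set x in B | g (B :\ x)]| =
             \sum_(D | g D) #|rooms_at D|.
  under eq_bigr do rewrite -sum1dep_card.
  rewrite (exchange_big_dep xpredT) //=.
  under [RHS]eq_bigr do rewrite -sum1dep_card.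
  rewrite [RHS](exchange_big_dep xpredT) //=; apply: eq_bigr => x _.
  rewrite (reindex_onto (fun D => x |: D) (fun B => B :\ x)) /=; last first.
    by move=> B /and3P[_ xB _]; rewrite setD1K.
  apply: eq_bigl => D; rewrite setU11 /=.
  have [xD|xD] := boolP (x \in D).
    rewrite [_ == D](_ : _ = false) ?andbF //; apply/eqP => e.
    by move: xD; rewrite -e !inE eqxx.
  by rewrite setU1K // eqxx andbT andbC.
have odd_doors : odd (\sum_(D | g D) #|rooms_at D|).
  have gout : g (outer i0).
    apply/eqP; rewrite -imset_comp -[RHS]imset_id.
    by apply: eq_imset => k /=; rewrite c_slack.
  rewrite (bigD1 (outer i0)) //= oddD.
  rewrite (@odd_rooms_at _ i0) ?outer_dominant ?card_outer ?(eqP gout) // eqxx.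
  rewrite (big_morph odd oddD (erefl : odd 0 = false)) big1 // => D.
  case/andP => gD Dout.
  have [DI|DI] := boolP (dominant rk D && (#|D|.+1 == #|I|)).
    case/andP: DI => domD /eqP cD.
    by rewrite (@odd_rooms_at _ i0) ?(eqP gD) // (negbTE Dout).
  suff -> : rooms_at D = set0 by rewrite cards0.
  apply/eqP; rewrite -subset0; apply/subsetP => x; rewrite inE.
  case/and3P => xD domx cx; case/negP: DI.
  rewrite (dominantS (subsetUr _ _) domx) /=.
  by rewrite cardsU1 xD add1n in cx.
have [/existsP[B /and3P[B1 /eqP B2 /eqP B3]]|/existsPn none] := boolP
  [exists B : {set E}, [&& dominant rk B, #|B| == #|I| & c @: B == [set: I]]].
  by exists B.
move: odd_doors; rewrite -count (big_morph odd oddD (erefl : odd 0 = false)).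
rewrite big1 // => B /andP[domB /eqP cB]; apply: negbTE.
apply: odd_doors_of => //.
by have := none B; rewrite domB cB eqxx.
Qed.

End ColourfulRoom.

(** * Sperner's lemma on the grid points of a simplex *)

Section GridSperner.
Import mathcomp.boot.fintype mathcomp.boot.finset.
Variables (k N : nat).
Let K := k.+2.

(** The points of the standard simplex whose barycentric coordinates are
    multiples of [1 / N]. *)
Definition grid := {a : {ffun 'I_K -> 'I_N.+1} | \sum_i (a i : nat) == N}.

Definition coordinate (t : grid) (i : 'I_K) : nat := val t i.

Lemma sum_coordinate t : \sum_i coordinate t i = N.
Proof. exact/eqP/(valP t). Qed.

Lemma grid_exists (f : 'I_K -> nat) : \sum_i f i = N ->
  exists t : grid, forall i, coordinate t i = f i.
Proof.
move=> fN; have fle i : f i < N.+1 by rewrite ltnS -fN (bigD1 i) //= leq_addr.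
pose a : {ffun 'I_K -> 'I_N.+1} := [ffun i => inord (f i)].
have aN : \sum_i (a i : nat) == N.
  by apply/eqP; rewrite -[RHS]fN; apply: eq_bigr => i _; rewrite ffunE inordK.
by exists (exist _ a aN) => i; rewrite /coordinate /= ffunE inordK.
Qed.

Lemma ord_pred_closed_setT (Z : {set 'I_K}) :
  (forall z, z \in Z -> ord_pred z \in Z) -> Z != set0 -> Z = [set: 'I_K].
Proof.
move=> Zp /set0Pn[z zZ].
have down (m : nat) (i j : 'I_K) : i = j + m :> nat -> i \in Z -> j \in Z.
  elim: m i j => [|m IH] i j ij iZ.
    by rewrite (_ : j = i) //; apply: val_inj; rewrite /= ij addn0.
  apply: IH (Zp i iZ); rewrite /= (_ : (i + K).-1 = (j + m) + K); last first.
    by move: ij; rewrite /K; lia.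
  by rewrite modnDr modn_small //; have := ltn_ord i; rewrite ij /K; lia.
apply/setP => j; rewrite inE.
have Z0 : ord0 \in Z by apply: (down z z).
apply: (down (ord_max - j) ord_max) => /=; first by rewrite subnKC // -ltnS.
rewrite (_ : ord_max = ord_pred ord0); first exact: Zp.
by apply: val_inj; rewrite /= modn_small.
Qed.

(** If the label of a grid point always designates a coordinate that is not
    small, then all labels occur within one small cluster. The elements are the
    grid points and one slack element per coordinate, ordered by each coordinate
    with ties broken arbitrarily. A colourful dominant set has small diameter:
    were the minima of its coordinates not to add up to nearly [N], a grid
    point would exceed them all. Colours are labels shifted by one, for if the
    set contains the slack element of [z], then its points have a small
    coordinate [z], hence not the label [z], so the colour preceding [z] can
    only come from the preceding slack element; cyclically all slack elements
    would be present, which leaves no room for grid points. *)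
Theorem sperner_grid (l : grid -> 'I_K) : (forall t, K <= coordinate t (l t)) ->
  exists s : 'I_K -> grid, (forall i, l (s i) = i) /\
    forall i i' j, coordinate (s i) j < coordinate (s i') j + K.
Proof.
move=> lK.
pose M := #|{: grid}|.
(* The offset [N.+1 * M] exceeds the rank of every grid point. *)
pose rk (i : 'I_K) (e : grid + 'I_K) : nat := match e with
  | inl t => (coordinate t i * M + enum_rank t).+1
  | inr j => if j == i then 0 else (N.+1 * M).+1 + j end.
pose c (e : grid + 'I_K) := match e with inl t => ord_pred (l t) | inr j => j end.
have coordN t i : coordinate t i <= N by rewrite -ltnS /coordinate.
have rkl i t : rk i (inl t) < (N.+1 * M).+1.
  have := coordN t i; have := ltn_ord (enum_rank t); rewrite -/M /=.
  by move: (enum_rank t : nat) (coordinate _ _) => a b; nia.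
have [t0 _] : exists t : grid, forall i, coordinate t i = if i == ord0 then N else 0.
  by apply: grid_exists; rewrite -big_mkcond /= big_pred1_eq.
have [B [domB cB colB]] : exists B : {set grid + 'I_K},
    [/\ dominant rk B, #|B| = #|'I_K| & c @: B = [set: 'I_K]].
  apply: (@colourful_dominant_set _ _ _ _ inr) => //=.
  - move=> i [t|j] [t'|j'].
    + move=> [] e; congr inl; apply: enum_rank_inj; apply: val_inj => /=.
      have := congr1 (modn^~ M) e.
      by rewrite !modnMDl !modn_small.
    + by have := rkl i t; rewrite /=; case: eqP => // _; lia.
    + by have := rkl i t'; rewrite /=; case: eqP => // _; lia.
    + rewrite /=; case: eqP => [->|_]; case: eqP => [->|_] //= e.
      by congr inr; apply: val_inj => /=; lia.
  - by move=> ? ? [].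
  - move=> i [t|j] /=; first by rewrite eqxx.
    by move=> ji; rewrite eqxx; case: (eqVneq j i) ji => // ->; rewrite eqxx.
  - move=> i j [t|j']; last by rewrite codom_f.
    move=> ij _; have := rkl i t; rewrite /= eq_sym (negbTE ij); lia.
  - by exists (inl t0); apply/codomP => -[].
  - by rewrite card_ord.
pose Z := [set j : 'I_K | inr j \in B].
have dom t : exists2 i, i \notin Z &
    forall s, inl s \in B -> coordinate t i <= coordinate s i.
  have /dominantP/(_ (inl t))[i Hi] := domB; exists i.
    by rewrite inE; apply/negP => /Hi /=; rewrite eqxx.
  move=> s /Hi /=; have := ltn_ord (enum_rank s); rewrite -/M.
  move: (enum_rank t : nat) (enum_rank s : nat) (coordinate _ _) (coordinate _ _).
  by nia.
have [i1 i1Z _] := dom t0.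
have [s0 s0B] : exists s, inl s \in B.
  have : i1 \in c @: B by rewrite colB inE.
  by case/imsetP => -[s|j] jB e; [exists s|rewrite inE e jB in i1Z].
pose argmin i := [arg min_(s < s0 | inl s \in B) coordinate s i].
pose m i := coordinate (argmin i) i.
have amP i : inl (argmin i) \in B /\ forall s, inl s \in B -> m i <= coordinate s i.
  by rewrite /m /argmin; case: arg_minnP.
have big : N < \sum_(i < K | i \notin Z) (m i).+1.
  rewrite ltnNge; apply/negP => small.
  (* Otherwise this grid point exceeds all minima at once. *)
  pose rest := N - \sum_(i < K | i \notin Z) (m i).+1.
  pose f i := if i \notin Z then (m i).+1 + (if i == i1 then rest else 0) else 0.
  have [t tf] : exists t : grid, forall i, coordinate t i = f i.
    apply: grid_exists; rewrite /f -big_mkcond /= big_split /= -big_mkcondr /=.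
    rewrite [X in _ + X](big_pred1 i1) ?subnKC // => i.
    by rewrite /=; have [->|_] := eqVneq i i1; rewrite ?i1Z ?andbF.
  have [i iZ Hi] := dom t; have [amB _] := amP i.
  by have := Hi _ amB; rewrite tf /f iZ addSn ltnNge leq_addr.
have sumM : N < \sum_(i < K | i \notin Z) m i + K.
  apply: leq_trans big _; under eq_bigr do rewrite -addn1.
  rewrite big_split /= leq_add2l sum1_card -[X in _ <= X]card_ord.
  exact: max_card.
have smallZ s j : inl s \in B -> j \in Z -> coordinate s j < K.
  move=> sB jZ; rewrite -(ltn_add2l (\sum_(i < K | i \notin Z) m i)).
  apply: leq_ltn_trans sumM; rewrite addnC -[X in _ <= X](sum_coordinate s).
  rewrite [X in _ <= X](bigD1 j) //= leq_add2l.
  rewrite [X in _ <= X](bigID (fun i => i \in Z)) /=.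
  apply: leq_trans (leq_addl _ _).
  rewrite [X in _ <= X](eq_bigl (fun i => i \notin Z)); last first.
    by move=> i; have [->|//] := eqVneq i j; rewrite jZ.
  by apply: leq_sum => i _; have [_ ->] := amP i.
have smallC s j : inl s \in B -> j \notin Z -> coordinate s j < m j + K.
  move=> sB jZ.
  rewrite -(ltn_add2r (\sum_(i < K | (i \notin Z) && (i != j)) m i)) addnAC.
  move: sumM; rewrite (bigD1 j) //=; apply: leq_ltn_trans.
  rewrite -[X in _ <= X](sum_coordinate s) [X in _ <= X](bigID (fun i => i \in Z)) /=.
  apply: leq_trans (leq_addl _ _).
  rewrite [X in _ <= X](bigD1 j) //= leq_add2l.
  by apply: leq_sum => i _; have [_ ->] := amP i.
have Z0 : Z = set0.
  apply/eqP; rewrite -[_ == _]negbK; apply/negP => Zn0.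
  suff ZT : Z = [set: 'I_K] by rewrite ZT inE in i1Z.
  apply: ord_pred_closed_setT Zn0 => z zZ.
  have : ord_pred z \in c @: B by rewrite colB inE.
  case/imsetP => -[s|j] jB; last by move=> /= ->; rewrite inE.
  move=> /(can_inj (@ord_predK _)) e.
  by have := lK s; rewrite -e leqNgt (smallZ s).
have /fin_all_exists[s Hs] : forall i : 'I_K, exists s, inl s \in B /\ l s = i.
  move=> i; have : ord_pred i \in c @: B by rewrite colB inE.
  case/imsetP => -[s|j] jB; first by move=> /(can_inj (@ord_predK _)) ->; exists s.
  by have : j \in Z; [rewrite inE|rewrite Z0 inE].
exists s; split=> [i|i i' j]; first by have [] := Hs i.
have jZ : j \notin Z by rewrite Z0 inE.
have [sB _] := Hs i; have [s'B _] := Hs i'.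
apply: leq_trans (smallC _ _ sB jZ) _; rewrite leq_add2r.
by have [_ ->] := amP j.
Qed.
End GridSperner.

Import Order.TTheory GRing.Theory Num.Theory.
Import numFieldNormedType.Exports.

Local Open Scope ring_scope.

(** * Nonnegative vectors with disjoint supports *)

Section DisjointSupports.
Import mathcomp.boot.fintype mathcomp.boot.finset.
Variables (R : realFieldType) (n : nat).
Implicit Types v w : 'rV[R]_n.

Definition pospart v : 'rV[R]_n := \row_i Num.max (v 0 i) 0.
Definition mass v : R := \sum_i v 0 i.
Definition supp v : {set 'I_n} := [set i | v 0 i != 0].
Definition nonneg v := forall i, 0 <= v 0 i.

Lemma massD v w : mass (v + w) = mass v + mass w.
Proof. by rewrite /mass -big_split; apply: eq_bigr => i _; rewrite mxE. Qed.

Lemma massZ a v : mass (a *: v) = a * mass v.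
Proof. by rewrite /mass mulr_sumr; apply: eq_bigr => i _; rewrite mxE. Qed.

Lemma massN v : mass (- v) = - mass v.
Proof. by rewrite -scaleN1r massZ mulN1r. Qed.

Lemma pospart_ge0 v : nonneg (pospart v).
Proof. by move=> i; rewrite mxE le_max lexx orbT. Qed.

Lemma pospartB v : pospart v - v = pospart (- v).
Proof. by apply/rowP => i; rewrite !mxE; case: leP => ?; case: leP => ?; lra. Qed.

Lemma nonneg_mass_gt0 v : nonneg v -> v != 0 -> 0 < mass v.
Proof.
move=> v0 vn0; rewrite lt_neqAle sumr_ge0 // andbT eq_sym.
apply: contra vn0 => /eqP tv; apply/eqP/rowP => i; rewrite mxE.
apply/eqP; move/eqP: tv; rewrite psumr_eq0 // => /allP/(_ i).
by apply; rewrite mem_index_enum.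
Qed.

Definition weight_in m (L : 'M[R]_(m, n)) v := [/\ (v <= L)%MS, nonneg v & mass v = 1].

(** A subspace closed under positive parts would be a sublattice of the coordinate
    space, hence spanned by nonnegative vectors with disjoint supports. Here the
    closure holds only for vectors of mass zero, which is enough: for two weight
    vectors [u] and [v] of mass one, the minimum [u - pospart (u - v)] is in the
    subspace. Take weight vectors with inclusion-minimal supports. Two different
    minimal supports are disjoint, by minimality applied to such a minimum; and
    the chosen vectors span the nonnegative elements, by subtracting multiples
    that shrink the support, hence span everything. So there are at least as
    many of them as the dimension. *)
Theorem disjoint_weights m (L : 'M[R]_(m, n)) (nu : 'rV[R]_n) :
    (forall v, (v <= L)%MS -> mass v = 0 -> (pospart v <= L)%MS) ->
    weight_in L nu ->
  exists u : 'I_(\rank L) -> 'rV[R]_n, (forall j, weight_in L (u j)) /\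
    forall j j', j != j' -> [disjoint supp (u j) & supp (u j')].
Proof.
move=> Lpos [nuL nu0 nu1].
pose is_supp (A : {set 'I_n}) := `[< exists2 v, weight_in L v & supp v = A >].
pose M := [set A | minset is_supp A].
have /choice[u Hu] : forall A, exists v, A \in M -> weight_in L v /\ supp v = A.
  move=> A; have [AM|AM] := boolP (A \in M); last by exists 0.
  have /minsetp/asboolP[v wv sv] : minset is_supp A by move: AM; rewrite inE.
  by exists v.
have disj A B : A \in M -> B \in M -> A != B -> [disjoint A & B].
  move=> AM BM; rewrite -setI_eq0; apply: contraNT => AB0.
  have [[uL u0 u1] su] := Hu A AM; have [[vL v0 v1] sv] := Hu B BM.
  pose w := u A - pospart (u A - u B).
  have wE i : w 0 i = Num.min (u A 0 i) (u B 0 i).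
    by rewrite !mxE; case: leP => ?; case: leP => ?; lra.
  have wL : (w <= L)%MS.
    rewrite addmx_sub // -scaleN1r scalemx_sub // Lpos //.
      by rewrite addmx_sub // -scaleN1r scalemx_sub.
    by rewrite massD massN u1 v1 subrr.
  have w0 : nonneg w by move=> i; rewrite wE le_min u0 v0.
  have sw : supp w = A :&: B.
    have pos (x : R) : 0 <= x -> (x != 0) = (0 < x).
      by rewrite lt0r => ->; rewrite andbT.
    by apply/setP => i; rewrite -su -sv !inE !pos // wE lt_min.
  have AB : is_supp (A :&: B).
    apply/asboolP; have wn0 : w != 0.
      apply: contra AB0 => /eqP wz; rewrite -sw; apply/eqP/setP => i.
      by rewrite !inE wz mxE eqxx.
    have tw := nonneg_mass_gt0 w0 wn0.
    exists ((mass w)^-1 *: w).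
      split; first exact: scalemx_sub.
        by move=> i; rewrite mxE mulr_ge0 // invr_ge0 ltW.
      by rewrite massZ mulVf // gt_eqF.
    rewrite -sw; apply/setP => i; rewrite !inE mxE mulf_eq0 invr_eq0.
    by rewrite (gt_eqF tw).
  move: AM BM; rewrite !inE => /minsetP[_ minA] /minsetP[_ minB].
  by rewrite -{1}(minA _ AB (subsetIl _ _)) (minB _ AB (subsetIr _ _)).
pose U : 'M[R]_(#|M|, n) := \matrix_(j < #|M|) u (enum_val j).
have uU A : A \in M -> (u A <= U)%MS.
  move=> AM; apply: eq_row_sub (enum_rank_in AM A) _.
  by rewrite rowK enum_rankK_in.
have nnU : forall k v, (#|supp v| <= k)%N -> (v <= L)%MS -> nonneg v -> (v <= U)%MS.
  elim=> [|k IH] v.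
    rewrite leqn0 cards_eq0 => /eqP s0 _ _.
    rewrite (_ : v = 0) ?sub0mx //; apply/rowP => i; rewrite mxE; apply/eqP.
    by move/setP/(_ i): s0; rewrite !inE => /negbFE.
  move=> sk vL v0; have [->|vn0] := eqVneq v 0; first exact: sub0mx.
  have tv := nonneg_mass_gt0 v0 vn0.
  have sv : is_supp (supp v).
    apply/asboolP; exists ((mass v)^-1 *: v).
      split; first exact: scalemx_sub.
        by move=> i; rewrite mxE mulr_ge0 // invr_ge0 ltW.
      by rewrite massZ mulVf // gt_eqF.
    apply/setP => i; rewrite !inE mxE mulf_eq0 invr_eq0.
    by rewrite (gt_eqF tv).
  have [A minA Av] := minset_exists sv.
  have AM : A \in M by rewrite inE.
  have [[wL w0 w1] sw] := Hu A AM; set w := u A in wL w0 w1 sw.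
  have wpos i : i \in A -> 0 < w 0 i.
    by rewrite -sw inE lt_neqAle eq_sym w0 andbT.
  have wzero i : i \notin A -> w 0 i = 0.
    by rewrite -sw inE negbK => /eqP.
  have [i1 i1A] : exists i, i \in A.
    apply/set0Pn; apply: contra_eq_neq w1 => A0.
    rewrite /mass big1 1?eq_sym ?oner_neq0 // => i _; apply: wzero.
    by rewrite A0 inE.
  have [i0 i0A i0min] : exists2 i0, i0 \in A &
      forall i, i \in A -> v 0 i0 / w 0 i0 <= v 0 i / w 0 i.
    case: (@arg_minP _ _ _ i1 (fun i => i \in A) (fun i => v 0 i / w 0 i) i1A).
    by move=> i0; exists i0.
  set a := v 0 i0 / w 0 i0 in i0min.
  have vE : v = (v - a *: w) + a *: w by rewrite subrK.
  rewrite vE addmx_sub ?scalemx_sub ?uU // IH //; last 2 first.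
  - by rewrite addmx_sub // -scaleN1r !scalemx_sub.
  - move=> i; rewrite !mxE subr_ge0; have [iA|iA] := boolP (i \in A).
      by rewrite -ler_pdivlMr ?wpos // i0min.
    by rewrite wzero // mulr0.
  rewrite -ltnS; apply: leq_trans sk; apply: proper_card; apply/properP; split.
    apply/subsetP => i; rewrite !inE !mxE; apply: contraNN => /eqP vi.
    have iA : i \notin A by apply/negP => /(subsetP Av); rewrite inE vi eqxx.
    by rewrite vi wzero // mulr0 subrr.
  exists i0; first exact: (subsetP Av).
  by rewrite inE negbK !mxE /a divfK ?subrr // gt_eqF // wpos.
(* After removal of a multiple of [nu], a vector has mass zero, and it is then the
   difference of two nonnegative vectors of the subspace. *)
have LU : (L <= U)%MS.
  apply/row_subP => j; set v := row j L.
  have vL : (v <= L)%MS by apply: row_sub.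
  pose d := v - mass v *: nu.
  have dL : (d <= L)%MS by rewrite addmx_sub // -scaleN1r !scalemx_sub.
  have d0 : mass d = 0 by rewrite massD massN massZ nu1 mulr1 subrr.
  have pL := Lpos _ dL d0.
  have -> : v = pospart d - (pospart d - d) + mass v *: nu.
    by rewrite subKr subrK.
  rewrite addmx_sub //; last by rewrite scalemx_sub // (nnU _ _ (leqnn _)).
  rewrite addmx_sub //; first by rewrite (nnU _ _ (leqnn _)) //; apply: pospart_ge0.
  rewrite -scaleN1r scalemx_sub // (nnU _ _ (leqnn _)) //.
    by rewrite addmx_sub // -scaleN1r scalemx_sub.
  by rewrite pospartB; apply: pospart_ge0.
have rk : (\rank L <= #|M|)%N := leq_trans (mxrankS LU) (rank_leq_row U).
exists (fun j => u (enum_val (widen_ord rk j))); split=> [j|j j' jj'].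
  by have [] := Hu _ (enum_valP (widen_ord rk j)).
have [_ ->] := Hu _ (enum_valP (widen_ord rk j)).
have [_ ->] := Hu _ (enum_valP (widen_ord rk j')).
apply: disj; try exact: enum_valP.
by apply: contra jj' => /eqP/enum_val_inj/(congr1 val) /= e; apply/eqP/val_inj.
Qed.

End DisjointSupports.

Local Open Scope classical_set_scope.
Local Open Scope ring_scope.

(** * Bounds on the covering dimension *)

Section CoveringDimension.
Variable R : realType.
Implicit Type Y : topologicalType.

Lemma covering_dim_ge Y k : [set: Y] !=set0 ->
  (forall j, (j < k)%N -> ~ covering_dim_le Y j) ->
  (k%:R%:E <= covering_dim R Y)%E.
Proof.
move=> /set0P Y0 H; rewrite /covering_dim; case: asboolP => [e|_].
  by rewrite e eqxx in Y0.
apply/ereal_infP => _ [j /= jY <-]; rewrite lee_fin ler_nat leqNgt.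
by apply/negP => /H.
Qed.

Lemma covering_dim_geN1 Y : ((-1)%:E <= covering_dim R Y)%E.
Proof.
have [e|Y0] := pselect ([set: Y] = set0).
  by rewrite /covering_dim asboolT.
apply: (@le_trans _ _ 0%:R%:E); first by rewrite lee_fin lerN10.
apply: covering_dim_ge => //.
exact/set0P/eqP.
Qed.

Lemma covering_dim_le0 Y : (covering_dim R Y <= 0)%E -> [set: Y] !=set0 ->
  covering_dim_le Y 0.
Proof.
move=> dY Y0; apply: contrapT => nY.
have : (1%:R%:E <= covering_dim R Y)%E.
  by apply: covering_dim_ge => // -[].
by move=> /le_trans/(_ dY); rewrite lee_fin ler10.
Qed.

Lemma order_at_most_inj (T : Type) (V : set (set T)) n (B : 'I_n.+1 -> set T) x :
  order_at_most V n -> injective B -> (forall i, V (B i)) -> ~ forall i, B i x.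
Proof.
move=> Vn Binj VB Bx.
have cB : (range B #= `I_n.+1)%card.
  apply: card_eq_trans (inj_card_eq _) _; first by move=> i j _ _; apply: Binj.
  by rewrite card_eq_sym card_II.
have BV : range B `<=` V by move=> _ [i _ <-].
suff : set0 x by [].
by rewrite -(Vn _ BV cB) => _ [i _ <-].
Qed.

(** If the path [f] took two values, refining the cover by the complements of these
    values into disjoint open sets would give an open and closed set separating
    them, and disconnect the line. *)
Lemma covering_dim_le0_path Y (f : R -> Y) a b : covering_dim_le Y 0 ->
  accessible_space Y -> continuous f -> f a = f b.
Proof.
move=> Y0 T1 fc; apply: contrapT => fab.
pose U : set (set Y) := [set ~` [set f a]; ~` [set f b]].
have [|V [[finV oV covV] VU V1]] := Y0 U.
  split; first exact: finite_set2.
    move=> A [->|->]; apply: closed_openC; exact: accessible_closed_set1.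
  rewrite bigcup_setU !bigcup_set1 -setCI; apply/seteqP; split => // y _ [-> /=].
  exact: fab.
have [B VB Ba] : exists2 B, V B & B (f a).
  by have : [set: Y] (f a) by []; rewrite -covV => -[B]; exists B.
pose C := \bigcup_(B' in [set B' | V B' /\ B' <> B]) B'.
have BC y : ~ (B y /\ C y).
  move=> [By [B' [VB' B'B] B'y]].
  apply: (@order_at_most_inj _ V 1 (fun i => if i == ord0 then B else B') y V1).
  - move=> [i i2] [j j2]; case: i i2 => [|[|//]] i2; case: j j2 => [|[|//]] j2 /= e.
    + exact: val_inj.
    + by case: B'B.
    + by case: B'B.
    + exact: val_inj.
  - by move=> i; case: ifP.
  - by move=> i; case: ifP.
have BCT y : B y \/ C y.
  have : [set: Y] y by []; rewrite -covV => -[B' VB' B'y].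
  by have [<-|BB'] := pselect (B' = B); [left|right; exists B'].
have cB : B = ~` C.
  by apply/seteqP; split => y; [move=> By Cy; apply: (BC y)|case: (BCT y)].
have oC : open C by apply: bigcup_open => B' [/oV].
have cT : connected [set: R] by apply/connected_intervalP.
have fo A : open A -> open (f @^-1` A) by move: A; apply/continuousP.
have fBT : f @^-1` B = setT.
  apply: cT; first by exists a.
    exists (f @^-1` B); rewrite ?setTI //.
    by apply/fo/oV.
  exists (f @^-1` B); rewrite ?setTI // cB preimage_setC; apply: open_closedC.
  exact: (fo C).
have Bb : (f @^-1` B) b by rewrite fBT.
have [A [->|->] BA] := VU B VB; first exact: BA Ba erefl.
exact: BA Bb erefl.
Qed.

End CoveringDimension.

(** * Lebesgue's covering theorem *)

Section Simplex.
Variable R : realType.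

Lemma continuous_sum_coord m (b : 'I_m -> R) :
  continuous (fun t : 'rV[R]_m => \sum_i t 0 i * b i).
Proof.
apply: continuous_big => [|i _]; first exact: add_continuous.
move=> t; apply: (@continuousM R _ (fun t : 'rV[R]_m => t 0 i) (cst (b i))).
  exact: coord_continuous.
exact: cst_continuous.
Qed.

Definition simplex m : set 'rV[R]_m :=
  [set t | (forall i, 0 <= t 0 i) /\ \sum_i t 0 i = 1].

Lemma simplex_compact m : compact (simplex (m := m)).
Proof.
have cube : compact [set t : 'rV[R]_m | forall i, t ord0 i \in `[0, 1]].
  by apply: (@rV_compact R m (fun=> `[0, 1]%classic)) => i; apply: segment_compact.
apply: subclosed_compact _ cube _.
- have -> : @simplex m = (\bigcap_i [set t : 'rV[R]_m | 0 <= t 0 i]) `&`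
      [set t | \sum_i t 0 i = 1].
    by apply/seteqP; split => t [t0 t1]; split => // i; [move=> _|]; exact: t0.
  apply: closedI.
    apply: closed_bigI => i _.
    apply: (@closed_comp _ _ (fun t : 'rV[R]_m => t 0 i) [set x | 0 <= x]).
      by move=> t _; apply: coord_continuous.
    exact: closed_ge.
  apply: (@closed_comp _ _ (fun t : 'rV[R]_m => \sum_i t 0 i) [set x | x = 1]).
    move=> t _; under eq_fun do under eq_bigr do rewrite -[_ 0 _]mulr1.
    exact: continuous_sum_coord.
  exact: closed_eq.
- move=> t [t0 t1] i /=; rewrite in_itv /= t0 /= -t1 (bigD1 i) //= lerDl.
  by apply: sumr_ge0.
Qed.

(** An open form of the theorem of Knaster, Kuratowski and Mazurkiewicz, in which
    each set avoids one facet. Label a grid point by an index [i] such that a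
    whole ball around it, of radius a Lebesgue number [e] of the cover, lies in
    [O i]; such a point cannot be within [e] of the facet [i], as required to get
    a cluster of grid points bearing all labels. The balls of this cluster
    contain all its points. *)
Lemma simplex_kkm k (O : 'I_k.+2 -> set 'rV[R]_k.+2) :
    (forall i, open (O i)) ->
    (forall t, simplex t -> exists i, O i t) ->
    (forall i t, simplex t -> O i t -> 0 < t 0 i) ->
  exists2 t, simplex t & forall i, O i t.
Proof.
move=> oO covO posO.
have [e e0 He] : exists2 e : R, 0 < e &
    forall t, simplex t -> exists i, ball t e `<=` O i.
  have /compact_near_coveringP := @simplex_compact k.+2.
  move=> /(_ R 0^'+ (fun e t => exists i, ball t e `<=` O i) _)[].
    move=> t /covO[i Oit].
    have /nbhs_ballP[e /= e0 eO] : nbhs t (O i) by apply: open_nbhs_nbhs.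
    exists (ball t (e / 2), [set e' | e' < e / 2]) => /=.
      split; first by apply: nbhsx_ballx; rewrite divr_gt0.
      by apply: nbhs_right_lt; rewrite divr_gt0.
    move=> [t' e'] /= [tt' e'e]; exists i => s ts; apply: eO.
    apply: (ball_split tt'); apply: le_ball ts; exact: ltW.
  move=> e /= e0 He; exists (e / 2); first by rewrite divr_gt0.
  move=> t /He; apply => //=; last by rewrite divr_gt0.
  by rewrite sub0r normrN gtr0_norm ?divr_gt0 // ltr_pdivrMr // ltr_pMr // ltr1n.
pose N := (Num.truncn (k.+2%:R / e)).+1.
have N0 : 0 < N%:R :> R by rewrite ltr0n.
have Ne : k.+2%:R / N%:R < e.
  by rewrite ltr_pdivrMr // mulrC -ltr_pdivrMr // truncnS_gt.
pose pt (t : grid k N) : 'rV[R]_k.+2 := \row_i ((coordinate t i)%:R / N%:R).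
have ptS t : simplex (pt t).
  split=> [i|]; first by rewrite mxE divr_ge0.
  under eq_bigr do rewrite mxE; rewrite -mulr_suml -natr_sum sum_coordinate.
  by rewrite divff // gt_eqF.
have near_pt s t : (forall j, (coordinate s j < coordinate t j + k.+2)%N) ->
   (forall j, (coordinate t j < coordinate s j + k.+2)%N) -> ball (pt t) e (pt s).
  move=> st ts; split=> // i j; rewrite !mxE /ball /= -mulrBl normrM.
  rewrite [X in _ * X]gtr0_norm ?invr_gt0 //; apply: le_lt_trans Ne.
  rewrite ler_pM2r ?invr_gt0 // ler_norml.
  have := st j; have := ts j; move: (coordinate _ _) (coordinate _ _) => a b.
  rewrite -!(ltr_nat R) !natrD => h1 h2; apply/andP; split; lra.
have /choice[l Hl] : forall t : grid k N, exists i, ball (pt t) e `<=` O i.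
  by move=> t; apply: He.
have [|s [sl ss]] := @sperner_grid k N l.
  move=> t; rewrite leqNgt; apply/negP => small.
  have [j jl] : exists j : 'I_k.+2, j != l t.
    by have [->|l0] := eqVneq (l t) ord0; [exists ord_max|exists ord0; rewrite eq_sym].
  (* Moving the small coordinate [l t] of [t] to [j] leads to the facet [l t]. *)
  pose f i := if i == l t then 0%N else
    (coordinate t i + if i == j then coordinate t (l t) else 0)%N.
  have [|t' t'f] := @grid_exists k N f.
    rewrite (bigD1 (l t)) //= {1}/f eqxx add0n (bigD1 j) //= {1}/f (negbTE jl) eqxx.
    apply: etrans (sum_coordinate t).
    rewrite [RHS](bigD1 (l t)) //= [in RHS](bigD1 j) //=.
    rewrite -addnA addnCA; congr (_ + _)%N; congr (_ + _)%N.
    by apply: eq_bigr => i /andP[il ij]; rewrite /f (negbTE il) (negbTE ij) addn0.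
  have /Hl O' : ball (pt t) e (pt t').
    by apply: near_pt => i; rewrite t'f /f;
      (have [->|_] := eqVneq i (l t); [lia|case: ifP => _; lia]).
  have := posO _ _ (ptS t') O'; rewrite mxE t'f /f eqxx mul0r ltxx //.
exists (pt (s ord0)) => // i; rewrite -[i in O i]sl.
by apply: Hl; apply: near_pt => j; apply: ss.
Qed.

(** Lebesgue's covering theorem, for a space that contains a simplex and to which
    its barycentric coordinates extend. Refine the cover by the sets where one
    coordinate is positive, and merge the members of the refinement contained
    in the same set of the cover: by [simplex_kkm] the [k.+2] merged sets have a
    common point, which is then in [k.+2] distinct members, too many for an order
    of at most [k.+1]. *)
Lemma covering_dim_simplex k d (A : set 'rV[R]_d)
    (sg : 'rV[R]_k.+2 -> 'rV[R]_d) (b : 'I_k.+2 -> 'rV[R]_d -> R) :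
    continuous sg -> (forall i, continuous (b i)) ->
    (forall t, simplex t -> A (sg t)) ->
    (forall y, A y -> exists i, 0 < b i y) ->
    (forall t i, simplex t -> b i (sg t) = t 0 i) ->
  forall j, (j < k.+1)%N -> ~ covering_dim_le (A : Type) j.
Proof.
move=> sgc bc sgA bA bsg j jk dimA.
pose U i : set A := [set y | 0 < b i (val y)].
have [|V [[finV oV covV] VU Vj]] := dimA (range U).
  split.
  - exact: finite_image.
  - move=> _ [i _ <-]; exists [set y | 0 < b i y] => //.
    apply: (@open_comp _ _ (b i) [set x | 0 < x]); last exact: open_gt.
    by move=> y _; apply: bc.
  - apply/seteqP; split => // y _; have [i bi] := bA _ (set_valP y).
    by exists (U i) => //; exists i.
have /choice[c Hc] : forall B : set A, exists i, V B -> B `<=` U i.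
  move=> B; have [VB|nVB] := pselect (V B); last by exists ord0.
  by have [_ [i _ <-] BU] := VU B VB; exists i.
have /choice[G HG] : forall i, exists G : set 'rV[R]_d, open G /\
    val @^-1` G = \bigcup_(B in [set B | V B /\ c B = i]) B :> set A.
  move=> i.
  have [G oG GE] : open (\bigcup_(B in [set B | V B /\ c B = i]) B).
    by apply: bigcup_open => B [/oV].
  by exists G.
have [|||t tS Ht] := @simplex_kkm k (fun i => sg @^-1` G i).
- move=> i; apply: open_comp; first by move=> t _; apply: sgc.
  by have [] := HG i.
- move=> t tS; pose y : A := SigSub (mem_set (sgA t tS)).
  have : [set: A] y by []. rewrite -covV => -[B VB By].
  exists (c B); have [_ GE] := HG (c B).
  have : (val @^-1` G (c B)) y by rewrite GE; exists B.
  by [].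
- move=> i t tS Gt; pose y : A := SigSub (mem_set (sgA t tS)).
  have [_ GE] := HG i.
  have : (val @^-1` G i) y by [].
  rewrite GE => -[B [VB <-] By]; have := Hc B VB _ By.
  by rewrite /U /= bsg.
pose y : A := SigSub (mem_set (sgA t tS)).
have /choice[B HB] : forall i, exists B : set A, [/\ V B, c B = i & B y].
  move=> i; have [_ GE] := HG i.
  have : (val @^-1` G i) y by apply: Ht.
  by rewrite GE => -[B [VB cB] By]; exists B.
have jk2 : (j.+2 <= k.+2)%N by [].
apply: (@order_at_most_inj _ V j.+1 (fun i => B (widen_ord jk2 i)) y Vj).
- move=> i i' e; have [_ ci _] := HB (widen_ord jk2 i).
  have [_ ci' _] := HB (widen_ord jk2 i').
  by apply: val_inj; have := congr1 val ci; rewrite e ci' /= => ->.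
- by move=> i; have [] := HB (widen_ord jk2 i).
- by move=> i; have [] := HB (widen_ord jk2 i).
Qed.

End Simplex.

(** * Tverberg sets and the dimension of the convex hull *)

Section TverbergSets.
Variables (R : realType) (d : nat).

Lemma conv_hull_weights n (X : 'M[R]_(n, d)) (A : set 'rV[R]_d) (w : 'rV[R]_n) :
    nonneg w -> mass w = 1 -> (forall i, w 0 i != 0 -> A (row i X)) ->
  conv_hull A (w *m X).
Proof.
move=> w0 w1 wA C [/= cC AC].
(* A smallest convex set is closed under binary averages only, hence the induction
   on the number of points, with weights normalized at each stage. *)
have avg (s : seq 'I_n) : 0 < \sum_(i <- s) w 0 i ->
    C ((\sum_(i <- s) w 0 i)^-1 *: \sum_(i <- s) w 0 i *: row i X).
  elim: s => [|i s IH]; first by rewrite big_nil ltxx.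
  rewrite !big_cons; have [->|wi0] := eqVneq (w 0 i) 0.
    by rewrite scale0r !add0r.
  have wi : 0 < w 0 i by rewrite lt_neqAle eq_sym wi0 w0.
  have Ci : C (row i X) by apply/AC/wA.
  set W := \sum_(j <- s) w 0 j in IH *; set Y := \sum_(j <- s) _ in IH *.
  have W0 : 0 <= W by apply: sumr_ge0.
  move=> wiW; have [We|Wn0] := eqVneq W 0.
    suff -> : Y = 0 by rewrite We !addr0 scalerA mulVf ?scale1r.
    rewrite /Y big_seq big1 // => j js.
    move/eqP: We; rewrite /W psumr_eq0 // => /allP/(_ j js)/eqP ->.
    by rewrite scale0r.
  have {}Wn0 : 0 < W by rewrite lt_neqAle eq_sym Wn0.
  have l01 : 0 <= w 0 i / (w 0 i + W) <= 1.
    by rewrite divr_ge0 ?(ltW wiW) //= ler_pdivrMr // mul1r lerDl.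
  have := cC (row i X) (W^-1 *: Y) (@Itv01 R _ (andP l01).1 (andP l01).2).
  rewrite !inE => /(_ Ci (IH Wn0)); congr C.
  set l := w 0 i / (w 0 i + W) in l01 *.
  change (l *: row i X + (1 - l) *: (W^-1 *: Y) =
    (w 0 i + W)^-1 *: (w 0 i *: row i X + Y)).
  rewrite scalerDr !scalerA; congr (_ *: _ + _ *: _); first by rewrite mulrC.
  by rewrite /l; field; rewrite !gt_eqF.
have -> : w *m X = (\sum_i w 0 i)^-1 *: \sum_i w 0 i *: row i X.
  by rewrite -/(mass w) w1 invr1 scale1r mulmx_sum_row.
by apply: avg; rewrite -/(mass w) w1.
Qed.

Variables (S : {fset 'rV[R]_d}) (n : nat) (X : 'M[R]_(n, d)).
Hypothesis X_inj : injective (fun i => row i X).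
Hypothesis X_S : [set` S] = range (fun i => row i X).

(** Finite sets of points are presented as the rows of a matrix, so that a weighted
    mean is a product [w *m X]; the parts of a partition are the fibres of [f]. *)
Lemma tverberg_weights r (f : 'I_n -> 'I_r) (w : 'I_r -> 'rV[R]_n) p :
    (forall j, nonneg (w j)) -> (forall j, mass (w j) = 1) ->
    (forall i j, w j 0 i != 0 -> f i = j) -> (forall j, w j *m X = p) ->
  tverberg_set S r p.
Proof.
move=> w0 w1 wf wX.
exists (fun j => (fun i => row i X) @` [set i | f i = j]) => [|j]; last first.
  by rewrite -(wX j); apply: conv_hull_weights => // i /wf ij; exists i.
split.
- rewrite X_S; apply/seteqP; split => [_ [j _ [i _ <-]]|_ [i _ <-]]; first by exists i.
  by exists (f i) => //; exists i.
- apply/trivIsetP => j j' _ _ jj'; apply/seteqP; split => //.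
  move=> y [[i /= fi <-] [i' /= fi' /X_inj e]].
  by move: jj'; rewrite -fi -fi' e eqxx.
- move=> j _; have [i wi] : exists i, w j 0 i != 0.
    apply: contrapT => /forallNP wz; have := w1 j; rewrite /mass big1 => [|i _].
      by move/eqP; rewrite eq_sym oner_eq0.
    by have /negP := wz i; rewrite negbK => /eqP.
  by exists (row i X), i => //=; apply: wf.
Qed.

Lemma tverberg1_nonempty : (0 < n)%N -> tverberg_set S 1 !=set0.
Proof.
move=> n0; pose i0 := Ordinal n0; exists (row i0 X).
apply: (@tverberg_weights 1 (fun=> ord0) (fun=> delta_mx 0 i0)) => [j i|j|i j _|j].
- by rewrite mxE ler0n.
- rewrite /mass (bigD1 i0) //= big1 => [|i /negbTE ii0];
    by rewrite !mxE ?ii0 ?eqxx ?addr0.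
- by rewrite [RHS]ord1.
- by rewrite -rowE.
Qed.

End TverbergSets.

Section DimensionOfHull.
Variables (R : realType) (d : nat) (S : {fset 'rV[R]_d}) (n : nat) (X : 'M[R]_(n, d)).
Hypothesis X_inj : injective (fun i => row i X).
Hypothesis X_S : [set` S] = range (fun i => row i X).

(** Appending a coordinate equal to one turns affine notions into linear ones: the
    rank is then one more than the dimension of the affine hull of the rows. *)
Definition homogenize m (Y : 'M[R]_(m, d)) : 'M[R]_(m, d + 1) := row_mx Y (const_mx 1).

Lemma mul_homogenize m (w : 'rV[R]_m) (Y : 'M[R]_(m, d)) :
  w *m homogenize Y = row_mx (w *m Y) (const_mx (mass w)).
Proof.
rewrite mul_mx_row; congr row_mx; apply/rowP => i; rewrite !mxE.
by apply: eq_bigr => j _; rewrite mxE mulr1.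
Qed.

Lemma massE m (w : 'rV[R]_m) : mass w = (w *m const_mx 1 : 'cV_1) 0 0.
Proof. by rewrite mxE; apply: eq_bigr => i _; rewrite mxE mulr1. Qed.

Lemma continuous_mulmxr m (Y : 'M[R]_(m, d)) :
  continuous (fun t : 'rV[R]_m => t *m Y).
Proof.
have -> : (fun t : 'rV[R]_m => t *m Y) = (fun t => \sum_i t 0 i *: row i Y).
  by apply/funext => t; rewrite mulmx_sum_row.
apply: continuous_big => [|i _]; first exact: add_continuous.
move=> t; apply: (@continuousZr_tmp _ _ _ (fun t : 'rV[R]_m => t 0 i)).
exact: coord_continuous.
Qed.

Lemma tverberg1_weights (w : 'rV[R]_n) :
  nonneg w -> mass w = 1 -> tverberg_set S 1 (w *m X).
Proof.
move=> w0 w1.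
apply: (tverberg_weights X_inj X_S (f := fun=> ord0) (w := fun=> w)) => //.
by move=> i j _; rewrite [RHS]ord1.
Qed.

Lemma tverberg1_sub_conv : tverberg_set S 1 `<=` conv_hull [set` S].
Proof.
move=> p [A [AS _ _] /(_ ord0) Ap] C [cC SC]; apply: Ap; split => // y Ay.
by apply: SC; rewrite -AS; exists ord0.
Qed.

(** The first Tverberg set is the convex hull. It contains the simplex on an
    affine basis [g] chosen among the points, and the barycentric coordinates [b]
    of this basis still add up to one on the whole hull, so that some of them
    is positive everywhere. *)
Lemma tverberg_dim1_ge : (0 < n)%N ->
  ((\rank (homogenize X)).-1%:R%:E <= tverberg_dim S 1)%E.
Proof.
move=> n0; have [p0 Tp0] := tverberg1_nonempty X_inj X_S n0.
apply: covering_dim_ge; first by exists (SigSub (mem_set Tp0)).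
set H := homogenize X.
have [g [gfree gspan]] : exists g : 'I_(\rank H) -> 'I_n,
    row_free (rowsub g H) /\ (H <= rowsub g H)%MS.
  by exists (maxrankfun H); rewrite maxrowsub_free; split => //; rewrite eq_maxrowsub.
case: (\rank H) g gfree gspan => [|[|k]] //= g gfree gspan.
set V := rowsub g H in gfree gspan; pose B := pinvmx V.
have VB : V *m B = 1%:M by apply: mulmxVp.
have VE : V = homogenize (rowsub g X).
  by apply/matrixP => i j; rewrite !mxE; case: splitP => j'; rewrite !mxE.
pose b i (y : 'rV[R]_d) := (homogenize y *m B) 0 i.
have bE i y : b i y = \sum_j y 0 j * B (lshift 1 j) i + B (rshift d 0) i.
  rewrite /b mxE big_split_ord /= big_ord1; congr (_ + _).
    by apply: eq_bigr => j _; rewrite row_mxEl.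
  by rewrite row_mxEr mxE mul1r.
apply: (@covering_dim_simplex R k d _ (fun t => t *m rowsub g X) b).
- exact: continuous_mulmxr.
- move=> i; have -> : b i = fun y => \sum_j y 0 j * B (lshift 1 j) i + B (rshift d 0) i.
    by apply/funext => y; rewrite bE.
  move=> y; apply: (@continuousD _ _ _
    (fun y : 'rV[R]_d => \sum_j y 0 j * B (lshift 1 j) i) (cst _)).
    exact: continuous_sum_coord.
  exact: cst_continuous.
- move=> t [t0 t1].
  (* [w] extends the weights [t] on the basis by zero. *)
  pose w : 'rV[R]_n := t *m rowsub g 1%:M.
  have -> : t *m rowsub g X = w *m X by rewrite -mulmxA -rowsubE.
  apply: tverberg1_weights => [i|].
    by rewrite mxE sumr_ge0 // => j _; rewrite mulr_ge0 // !mxE ler0n.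
  rewrite massE /w -mulmxA -rowsubE (_ : rowsub g _ = const_mx 1) -?massE //.
  by apply/matrixP => i j; rewrite !mxE.
- move=> y /tverberg1_sub_conv Sy.
  have : \sum_i b i y = 1.
    have H1 (h : 'rV[R]_(d + 1)) : (h <= V)%MS -> h 0 (rshift d 0) = 1 ->
        \sum_i (h *m B) 0 i = 1.
      move=> /submxP[c ->] cV1; rewrite -mulmxA VB mulmx1 -cV1 VE mul_homogenize.
      by rewrite row_mxEr mxE.
    apply: (Sy [set y | \sum_i b i y = 1]); split => [u v l|u /=].
      rewrite !inE /= => bu bv.
      have bl i : b i (conv l u v) = l%:num * b i u + (1 - l%:num) * b i v.
        have cE j : (conv l u v : 'rV[R]_d) 0 j = l%:num * u 0 j + (1 - l%:num) * v 0 j.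
          by rewrite mxE !mxE.
        rewrite !bE; under eq_bigr do rewrite cE mulrDl -!mulrA.
        by rewrite big_split /= -!mulr_sumr; ring.
      under eq_bigr do rewrite bl.
      by rewrite big_split /= -!mulr_sumr bu bv !mulr1 subrKC.
    move=> Su; have : [set` S] u by [].
    rewrite X_S => -[i _ <-]; apply: H1; last by rewrite row_mxEr mxE.
    have -> : homogenize (row i X) = row i H by rewrite row_row_mx row_const.
    exact: submx_trans (row_sub i H) gspan.
  move=> sb; apply: contrapT => /forallNP bn.
  have : \sum_i b i y <= 0 by apply: sumr_le0 => i _; rewrite leNgt; apply/negP/bn.
  by rewrite sb ler10.
- move=> t i [t0 t1]; rewrite /b.
  have -> : homogenize (t *m rowsub g X) = t *m V.
    rewrite VE mul_homogenize; congr row_mx.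
    by rewrite /mass t1.
  by rewrite -mulmxA VB mulmx1.
Qed.

End DimensionOfHull.

(** * Radon points and Tverberg partitions *)

Section Radon.
Variables (R : realType) (d : nat) (S : {fset 'rV[R]_d}) (n : nat) (X : 'M[R]_(n, d)).
Hypothesis X_inj : injective (fun i => row i X).
Hypothesis X_S : [set` S] = range (fun i => row i X).

Definition dependence (v : 'rV[R]_n) := v *m X = 0 /\ mass v = 0.

Definition radon_point (v : 'rV[R]_n) : 'rV[R]_d :=
  (mass (pospart v))^-1 *: (pospart v *m X).

Lemma dependenceP v : (v <= kermx (homogenize X))%MS <-> dependence v.
Proof.
rewrite -(rwP sub_kermxP) mul_homogenize -row_mx0; split.
  by move=> /eq_row_mx[e1 /rowP/(_ 0)]; rewrite !mxE => e2; split.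
by move=> [-> ->]; congr row_mx; apply/rowP => i; rewrite !mxE.
Qed.

Lemma mass_pospartN (v : 'rV[R]_n) :
  mass v = 0 -> mass (pospart (- v)) = mass (pospart v).
Proof. by move=> v0; rewrite -pospartB massD massN v0 subr0. Qed.

Lemma mass_pospart_gt0 v : dependence v -> v != 0 -> 0 < mass (pospart v).
Proof.
move=> [_ v0] vn0; apply: nonneg_mass_gt0; first exact: pospart_ge0.
apply: contra vn0 => /eqP p0; have := mass_pospartN v0.
rewrite p0 => m0; have : pospart (- v) == 0.
  apply/negPn/negP => /(nonneg_mass_gt0 (pospart_ge0 _)).
  by rewrite m0 /mass big1 ?ltxx // => i _; rewrite mxE.
by rewrite -pospartB p0 sub0r oppr_eq0.
Qed.

Lemma radon_pointN v : dependence v -> radon_point (- v) = radon_point v.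
Proof.
move=> [vX v0]; rewrite /radon_point mass_pospartN //.
by rewrite -pospartB mulmxBl vX subr0.
Qed.

Lemma radon_pointZ (a : R) v : 0 < a -> radon_point (a *: v) = radon_point v.
Proof.
move=> a0; rewrite /radon_point.
have -> : pospart (a *: v) = a *: pospart v.
  by apply/rowP => i; rewrite !mxE maxr_pMr ?ltW // mulr0.
rewrite massZ -scalemxAl scalerA; congr (_ *: _).
by rewrite invfM mulrAC mulVf ?mul1r // gt_eqF.
Qed.

(** The negative part of a dependence has the same mass and the same weighted sum
    as its positive part, so the Radon point is in both hulls. *)
Lemma radon_point_tverberg v :
  dependence v -> v != 0 -> tverberg_set S 2 (radon_point v).
Proof.
move=> Dv vn0; have m0 := mass_pospart_gt0 Dv vn0.
pose sgn (j : 'I_2) : R := if j == ord0 then 1 else -1.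
apply: (tverberg_weights X_inj X_S
  (f := fun i => if 0 < v 0 i then ord0 else ord_max)
  (w := fun j => (mass (pospart v))^-1 *: pospart (sgn j *: v))).
- by move=> j i; rewrite mxE mulr_ge0 ?pospart_ge0 // invr_ge0 ltW.
- move=> j; rewrite massZ /sgn; case: ifP => _.
    by rewrite scale1r mulVf // gt_eqF.
  by rewrite scaleN1r mass_pospartN ?mulVf ?gt_eqF //; case: Dv.
- move=> i j; rewrite !mxE /sgn; case: (eqVneq j ord0) => [->|j0].
    rewrite mul1r; case: ltP => // vi; by rewrite mulr0 eqxx.
  have -> : j = ord_max by apply/val_inj; case: j j0 => -[|[|]].
  rewrite mulN1r; case: (ltP 0 (v 0 i)) => // vi.
  by rewrite max_r ?mulr0 ?eqxx // oppr_le0 ltW.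
- move=> j; rewrite -scalemxAl /sgn; case: ifP => _; first by rewrite scale1r.
  rewrite scaleN1r -[RHS]radon_pointN // /radon_point mass_pospartN //.
  by case: Dv.
Qed.

Lemma subtype_accessible (T : topologicalType) (A : set T) :
  accessible_space T -> accessible_space (A : Type).
Proof.
move=> T1 x y xy; have [|B [oB xB yB]] := T1 (val x) (val y).
  by apply: contra xy => /eqP/val_inj ->.
exists (val @^-1` B); split; first by exists B.
  by rewrite inE /=; rewrite inE in xB.
by rewrite inE /=; rewrite inE in yB.
Qed.

Lemma continuous_radon_point (u v : 'rV[R]_n) :
    (forall s, mass (pospart (u + s *: v)) != 0) ->
  continuous (fun s : R => radon_point (u + s *: v)).
Proof.
move=> m0.
have cpos i : continuous (fun s : R => pospart (u + s *: v) 0 i).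
  have -> : (fun s : R => pospart (u + s *: v) 0 i) =
      ((fun s => u 0 i + s * v 0 i : R^o) \max cst 0).
    by apply/funext => s; rewrite !mxE.
  move=> s; apply: (@continuous_max R R (fun s => u 0 i + s * v 0 i) (cst 0)).
    apply: cvgD; first exact: cvg_cst.
    apply: cvgM; [exact: cvg_id|exact: cvg_cst].
  exact: cst_continuous.
have cm : continuous (fun s : R => mass (pospart (u + s *: v))).
  by apply: continuous_big => //; exact: add_continuous.
have cX : continuous (fun s : R => pospart (u + s *: v) *m X).
  have -> : (fun s : R => pospart (u + s *: v) *m X) =
      (fun s => \sum_i pospart (u + s *: v) 0 i *: row i X).
    by apply/funext => s; rewrite mulmx_sum_row.
  apply: continuous_big => [|i _ s]; first exact: add_continuous.
  by apply: cvgZr_tmp; exact: cpos.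
rewrite /radon_point => s; apply: cvgZ; last exact: cX.
by apply: cvgV => //; apply: cm.
Qed.

(** The segment joining two independent dependences avoids zero, so its Radon
    points form a path in the second Tverberg set, and a path in a space of
    dimension at most zero is constant. *)
Lemma radon_point_constant u v : covering_dim_le (tverberg_set S 2 : Type) 0 ->
    dependence u -> u != 0 -> dependence v -> v != 0 ->
  radon_point u = radon_point v.
Proof.
move=> T0 Du u0 Dv v0.
have [[a vau]|indep] := pselect (exists a, v = a *: u).
  have a0 : a != 0 by apply: contra v0 => /eqP a0; rewrite vau a0 scale0r.
  rewrite vau; have [ap|an] := ltP 0 a; first by rewrite radon_pointZ.
  have {}an : 0 < - a by rewrite oppr_gt0 lt_neqAle a0.
  rewrite -[RHS]radon_pointN; last by rewrite -vau.
  by rewrite -scaleNr radon_pointZ.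
have Dl s : dependence (u + s *: (v - u)).
  case: Du Dv => [uX um] [vX vm]; split.
    by rewrite mulmxDl -scalemxAl mulmxBl uX vX subrr scaler0 addr0.
  by rewrite massD massZ massD massN um vm subrr mulr0 addr0.
have l0 s : u + s *: (v - u) != 0.
  apply/eqP => e; have [s0|s0] := eqVneq s 0.
    by move: e u0; rewrite s0 scale0r addr0 => ->; rewrite eqxx.
  apply: indep; exists (1 - s^-1); apply: (scalerI s0).
  rewrite scalerA mulrBr mulr1 divff // scalerBl scale1r.
  move: e; rewrite scalerBr => /eqP; rewrite addrCA addr_eq0 => /eqP ->.
  by rewrite opprB.
pose f (s : R) : tverberg_set S 2 :=
  SigSub (mem_set (radon_point_tverberg (Dl s) (l0 s))).
have fc : continuous f.
  apply: continuous_comp_initial.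
  apply: (continuous_radon_point (v := v - u)) => s.
  by rewrite gt_eqF // mass_pospart_gt0.
have := covering_dim_le0_path 0 1 T0 _ fc.
move=> /(_ (subtype_accessible (hausdorff_accessible (@norm_hausdorff _ _)))).
move=> /(congr1 val) /=; by rewrite scale0r addr0 scale1r addrC subrK.
Qed.

(** Let [o] be the common Radon point. The weight vectors with mean [o] are those of
    the space [L] of vectors [v] with [v *m X = mass v *: o]. It strictly contains
    the affine dependences, and the constancy of Radon points says exactly that
    positive parts of dependences are in [L]. So [disjoint_weights] yields weight
    vectors with mean [o] and disjoint supports, which are the parts of a Tverberg
    partition. *)
Theorem tverberg_nonempty r : (tverberg_dim S 2 <= 0)%E ->
    (\rank (homogenize X) < n)%N -> (0 < r <= (n - \rank (homogenize X)).+1)%N ->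
  tverberg_set S r !=set0.
Proof.
move=> dimS rn /andP[r0 rle].
have kerS : (0 < \rank (kermx (homogenize X)))%N by rewrite mxrank_ker subn_gt0.
have /rowV0Pn[v0 /dependenceP Dv0 v0n0] : kermx (homogenize X) != 0.
  by rewrite -mxrank_eq0 -lt0n.
have T0 : covering_dim_le (tverberg_set S 2 : Type) 0.
  apply: covering_dim_le0 dimS _.
  by exists (SigSub (mem_set (radon_point_tverberg Dv0 v0n0))).
pose o := radon_point v0.
have oE v : dependence v -> pospart v *m X = mass (pospart v) *: o.
  move=> Dv; have [->|vn0] := eqVneq v 0.
    rewrite (_ : pospart 0 = 0) ?mul0mx; last first.
      by apply/rowP => i; rewrite !mxE maxxx.
    by rewrite /mass big1 ?scale0r // => i _; rewrite mxE.
  rewrite /o (radon_point_constant T0 Dv0 v0n0 Dv vn0) /radon_point scalerA.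
  by rewrite divff ?scale1r // gt_eqF // mass_pospart_gt0.
pose L := kermx (X - \matrix_(i < n) o).
have LP v : (v <= L)%MS <-> v *m X = mass v *: o.
  have vo : v *m (\matrix_(i < n) o) = mass v *: o.
    rewrite mulmx_sum_row /mass scaler_suml; apply: eq_bigr => i _.
    by rewrite rowK.
  rewrite -(rwP sub_kermxP) mulmxBr vo; split => [/eqP|->]; last by rewrite subrr.
  by rewrite subr_eq0 => /eqP.
have Lpos v : (v <= L)%MS -> mass v = 0 -> (pospart v <= L)%MS.
  move=> /LP vX vm; apply/LP/oE; split => //.
  by rewrite vX vm scale0r.
have m0 := mass_pospart_gt0 Dv0 v0n0.
pose nu := (mass (pospart v0))^-1 *: pospart v0.
have nuL : weight_in L nu.
  have nu1 : mass nu = 1 by rewrite massZ mulVf // gt_eqF.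
  split => //; last by move=> i; rewrite mxE mulr_ge0 ?pospart_ge0 // invr_ge0 ltW.
  by apply: scalemx_sub; apply/LP/oE.
have rL : (n - \rank (homogenize X) < \rank L)%N.
  rewrite -mxrank_ker; apply: rank_ltmx; rewrite ltmxE; apply/andP; split.
    apply/rV_subP => v /dependenceP[vX vm]; apply/LP.
    by rewrite vX vm scale0r.
  apply/negP => LH; have [nu_L _ nu1] := nuL.
  have /dependenceP[_ /eqP] := submx_trans nu_L LH.
  by rewrite nu1 oner_eq0.
have [u [uw udisj]] := disjoint_weights Lpos nuL.
have rL2 : (r <= \rank L)%N by apply: leq_trans rle rL.
case: r r0 rle rL2 => // r _ _ rL2.
pose w (j : 'I_r.+1) := u (widen_ord rL2 j).
have wP j : weight_in L (w j) by exact: uw.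
(* Points outside all the supports join the part of index zero. *)
exists o; apply: (tverberg_weights X_inj X_S (w := w)
   (f := fun i => odflt ord0 [pick j | w j 0 i != 0])).
- by move=> j; have [] := wP j.
- by move=> j; have [] := wP j.
- move=> i j wij; case: pickP => [j' wij' /=|/(_ j)]; last by rewrite wij.
  apply/eqP/negPn/negP => jj'.
  have /udisj : widen_ord rL2 j' != widen_ord rL2 j.
    by apply: contra jj' => /eqP/(congr1 val)/= e; apply/eqP/val_inj.
  move=> /pred0P/(_ i) /=; by rewrite !inE wij wij'.
- by move=> j; have [/LP -> _ ->] := wP j; rewrite scale1r.
Qed.

End Radon.

(** * The sum of the dimensions *)

Lemma fset_rows (R : realType) (d : nat) (S : {fset 'rV[R]_d}) :
  exists X : 'M[R]_(#|` S|, d),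
    injective (fun i => row i X) /\ [set` S] = range (fun i => row i X).
Proof.
exists (\matrix_(i < #|` S|) nth 0 (enum_fset S) i).
split=> [i j|]; first rewrite !rowK => /eqP.
  by rewrite nth_uniq ?fset_uniq // => /eqP/val_inj.
apply/seteqP; split => [x /= xS|_ [i _ <-]] /=; last by rewrite rowK mem_nth.
have xi : (index x (enum_fset S) < #|` S|)%N by rewrite index_mem.
by exists (Ordinal xi) => //; rewrite rowK nth_index.
Qed.

Local Open Scope ereal_scope.

Theorem theorem4 (R : realType) (d : nat) (hd : (0 < d)%N)
    (S : {fset 'rV[R]_d}) (hS : tverberg_dim S 2 <= 0) :
  0 <= \sum_(1 <= r < #|` S|.+1) tverberg_dim S r.
Proof.
have [X [X_inj X_S]] := fset_rows S.
have [n0|n0] := posnP #|` S|; first by rewrite n0 big_geq.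
set n := #|` S| in X X_inj X_S n0 *.
set rho : nat := \rank (homogenize X).
have rho_n : (rho <= n)%N := rank_leq_row _.
have rho0 : (0 < rho)%N.
  rewrite lt0n mxrank_eq0; apply/eqP => /matrixP/(_ (Ordinal n0) (rshift d ord0)).
  by rewrite row_mxEr !mxE => /eqP; rewrite oner_eq0.
have nonempty r : (0 < r <= (n - rho).+1)%N -> tverberg_set S r !=set0.
  move=> r_small; move: (rho_n); rewrite leq_eqVlt => /orP[/eqP e|rn].
    move: r_small; rewrite e subnn => /andP[r0 r1].
    by rewrite (_ : r = 1%N); [exact: tverberg1_nonempty X_inj X_S n0|lia].
  exact: (tverberg_nonempty X_inj X_S hS).
(* A lower bound for each dimension; these bounds add up to zero. *)
pose h (r : nat) : R :=
  ((if r == 1%N then rho.-1%:R else 0) - ((n - rho).+1 < r)%N%:R)%R.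
have hle r : (0 < r)%N -> ((h r)%:E <= tverberg_dim S r).
  rewrite /h => r0; have [rsmall|rbig] := leqP r (n - rho).+1; last first.
    have -> : (r == 1%N) = false by apply/eqP; lia.
    by rewrite sub0r; exact: covering_dim_geN1.
  rewrite subr0; have [->|r1] := eqVneq r 1%N; first exact: tverberg_dim1_ge.
  have [|p Tp] := nonempty r; first by rewrite r0.
  apply: (@covering_dim_ge R _ 0) => //; by exists (SigSub (mem_set Tp)).
have hsum : (\sum_(1 <= r < n.+1) h r = 0)%R.
  rewrite sumrB big_ltn // eqxx [X in (_ + X - _)%R]big_nat_cond.
  rewrite big1 ?addr0; last first.
    by move=> r /andP[/andP[r1 _] _]; rewrite gtn_eqF.
  rewrite -natr_sum (@big_cat_nat _ _ _ (n - rho).+2) //=; last by lia.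
  rewrite big_nat_cond big1 ?add0n; last first.
    by move=> r /andP[/andP[_ rm] _]; rewrite ltnNge -ltnS rm.
  rewrite (eq_big_nat _ _ (F2 := fun=> 1%N)); last by move=> r /andP[-> _].
  rewrite sum_nat_const_nat muln1 (_ : n.+1 - _ = rho.-1)%N ?subrr //; lia.
apply: (@le_trans _ _ (\sum_(1 <= r < n.+1) (h r)%:E)).
  by rewrite sumEFin hsum.
rewrite !big_nat; apply: lee_sum => r /andP[r0 _]; exact: hle.
Qed.
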